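(* Every cancellation consistent dimer without triangles is of bounded type.
   Context: A dimer $Q$ is a finite set of arcs on a closed oriented surface with finite puncture set $Q_0$, arcs meeting only at punctures, cutting the surface into contractible polygons each bounded by at least three arcs, all arcs on the boundary of one polygon oriented in the same direction (clockwise or counterclockwise). It is viewed as a quiver with vertices $Q_0$, arrows the arcs. F-term equivalence $\sim$ on paths is the equivalence relation generated by replacing, inside a path, the path $r_a^+$ (the boundary of one polygon adjacent to an arc $a$, with $a$ removed) by $r_a^-$ (the same for the other polygon adjacent to $a$). For a vertex $v$, $\ell_v$ denotes the boundary cycle of any polygon at $v$ starting at $v$ (independent of choice up to $\sim$), written $\ell$. $Q$ is cancellation consistent if $p\ell\sim q\ell$ implies $p\sim q$. $Q$ is without triangles if no polygon is bounded by exactly three arcs. $Q$ is of bounded type if every F-term equivalence class of paths has bounded length (equivalently is finite). *)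

(* Defs.v *)
From HB Require Import structures.
From Stdlib Require Import Relations.
From mathcomp Require Import all_boot all_fingroup.
Set Implicit Arguments. Unset Strict Implicit. Unset Printing Implicit Defensive.

(* A dimer is encoded by its quiver (vertices = punctures, arrows = arcs, with
   tail/head maps) and two permutations of the arrows:
   - [dpos a] = the arrow following [a] on the boundary of the unique
     clockwise polygon containing [a];
   - [dneg a] = the arrow following [a] on the boundary of the unique
     counterclockwise polygon containing [a].
   The polygons are the cycles of [dpos] and [dneg]. *)
Record dimer := Dimer {
  dV : finType;
  dA : finType;
  tl : dA -> dV;
  hd : dA -> dV;
  dpos : {perm dA};
  dneg : {perm dA} }.

Section Dimer.
Variable Q : dimer.
Local Notation V := (dV Q).
Local Notation A := (dA Q).

(* rotation around the head vertex of an arrow: pass through the clockwise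
   polygon corner, then back through the counterclockwise one *)
Definition rot (a : A) : A := ((dneg Q)^-1)%g (dpos Q a).

(* The combinatorial conditions saying the data come from arcs on a closed
   oriented surface cutting it into polygons with >= 3 sides, boundaries
   consistently oriented. *)
Definition is_dimer : Prop :=
  [/\ (forall a : A, tl (dpos Q a) = hd a /\ tl (dneg Q a) = hd a),
      (forall a : A, 3 <= fingraph.order (dpos Q) a /\ 3 <= fingraph.order (dneg Q) a),
      (forall v : V, exists a : A, hd a = v) &
      (* the link of every puncture is a single circle *)
      (forall a b : A, hd a = hd b -> fconnect rot a b) ].

Definition without_triangles : Prop :=
  forall a : A, fingraph.order (dpos Q) a <> 3 /\ fingraph.order (dneg Q) a <> 3.

Fixpoint is_walk (v : V) (s : seq A) : bool :=
  match s with
  | [::] => true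
  | a :: s' => (tl a == v) && is_walk (hd a) s'
  end.

Definition qpath := (V * seq A)%type.
Definition valid (p : qpath) : bool := is_walk p.1 p.2.
Definition pend (p : qpath) : V := last p.1 (map (@hd Q) p.2).

(* r_a^+ and r_a^- : boundary of the polygon adjacent to a, with a removed *)
Definition rpos (a : A) : seq A :=
  [seq iter k (dpos Q) a | k <- iota 1 (fingraph.order (dpos Q) a).-1].
Definition rneg (a : A) : seq A :=
  [seq iter k (dneg Q) a | k <- iota 1 (fingraph.order (dneg Q) a).-1].

Definition fstep (p q : qpath) : Prop :=
  p.1 = q.1 /\
  exists (x y : seq A) (a : A),
    p.2 = x ++ rpos a ++ y /\ q.2 = x ++ rneg a ++ y.

Definition fterm : qpath -> qpath -> Prop := clos_refl_sym_trans qpath fstep.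

Definition face_cycle_at (v : V) (c : seq A) : Prop :=
  exists a : A, tl a = v /\
    (c = [seq iter k (dpos Q) a | k <- iota 0 (fingraph.order (dpos Q) a)] \/
     c = [seq iter k (dneg Q) a | k <- iota 0 (fingraph.order (dneg Q) a)]).

Definition cancellation_consistent : Prop :=
  forall p q : qpath, valid p -> valid q ->
  forall c c' : seq A, face_cycle_at (pend p) c -> face_cycle_at (pend q) c' ->
  fterm (p.1, p.2 ++ c) (q.1, q.2 ++ c') -> fterm p q.

Definition bounded_type : Prop :=
  forall p : qpath, valid p ->
  exists n : nat, forall q : qpath, fterm p q -> size q.2 <= n.

End Dimer.

(* Main.v *)
(* Modulo F-term equivalence, paths form a category that behaves like a Garside
   category with Garside element l, the boundary of any polygon. If an element
   starts both with a and with a distinct arc b, then either l divides it or a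
   and b are neighbours, the successors of one arc c in its two polygons, and
   r_c^+ ~ r_c^- divides it; polygons having at least four sides is what makes
   this work. Consequently common multiples of an arc and a divisor of l (a run
   along the boundary of a polygon) are controlled by another divisor of l, so
   the products of k divisors of l are closed under passing to suffixes. A path
   of length k is such a product, and these form finitely many classes. If
   q ~ p is too long, two suffixes s and u s of q are equivalent with u
   nonempty, and cancelling s makes u equivalent to an empty path, which is
   absurd. *)
Require Import Defs.
From Stdlib Require Import Relations.
From mathcomp Require Import all_boot all_fingroup.
Set Implicit Arguments. Unset Strict Implicit. Unset Printing Implicit Defensive.

(** * Words of arrows, polygon boundaries and F-term moves *)

Section Words.
Variable Q : dimer.
Local Notation A := (dA Q).
Local Notation V := (dV Q).
Implicit Types (a b c g : A) (s t u x y z w : seq A) (sg tau : bool) (v : V).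

Definition turn sg : A -> A := if sg then dpos Q else dneg Q.

Definition face sg a : seq A := traject (turn sg) a (fingraph.order (turn sg) a).
Definition rest sg a : seq A :=
  traject (turn sg) (turn sg a) (fingraph.order (turn sg) a).-1.

Definition fmove s t : Prop :=
  exists sg x y c, s = x ++ rest sg c ++ y /\ t = x ++ rest (~~ sg) c ++ y.

(** The number of moves is recorded because the divisibility arguments below descend on it. *)
Inductive chain : nat -> seq A -> seq A -> Prop :=
| chain0 s : chain 0 s s
| chainS n s t u : chain n s t -> fmove t u -> chain n.+1 s u.

Definition eqv s t : Prop := exists n, chain n s t.
Local Notation "s ~~~ t" := (eqv s t) (at level 70).

Definition wend v s : V := last v (map (@hd Q) s).

Lemma turn_inj sg : injective (turn sg).
Proof. by case: sg; apply: perm_inj. Qed.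

Lemma map_iter_traject (f : A -> A) a k n :
  [seq iter i f a | i <- iota k n] = traject f (iter k f a) n.
Proof. by elim: n k => //= n IH k; rewrite IH. Qed.

Lemma rposE a : rpos a = rest true a.
Proof. exact: map_iter_traject. Qed.

Lemma rnegE a : rneg a = rest false a.
Proof. exact: map_iter_traject. Qed.

Lemma order_predK sg a :
  (fingraph.order (turn sg) a).-1.+1 = fingraph.order (turn sg) a.
Proof. by rewrite prednK // order_gt0. Qed.

Lemma faceE sg a : face sg a = a :: rest sg a.
Proof. by rewrite /face -order_predK. Qed.

Lemma order_turn sg a k :
  fingraph.order (turn sg) (iter k (turn sg) a) = fingraph.order (turn sg) a.
Proof.
apply: eq_card => x; rewrite !inE.
have sym := fconnect_sym (@turn_inj sg).
by rewrite -(same_connect sym (fconnect_iter (turn sg) k a)).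
Qed.

Lemma face_turn sg a : face sg (turn sg a) = rest sg a ++ [:: a].
Proof.
rewrite /face (order_turn sg a 1) -order_predK trajectSr -cats1 -iterSr.
by rewrite order_predK iter_order //; apply: turn_inj.
Qed.

Lemma fmove_sym s t : fmove s t -> fmove t s.
Proof.
case=> sg [x [y [c [-> ->]]]]; exists (~~ sg), x, y, c.
by rewrite negbK.
Qed.

Lemma chain_trans m n s t u : chain m s t -> chain n t u -> chain (m + n) s u.
Proof.
move=> st tu; elim: tu st => [w|k w w' w'' _ IH stp] sw; first by rewrite addn0.
by rewrite addnS; apply: chainS stp; apply: IH.
Qed.

Lemma chain_sym n s t : chain n s t -> chain n t s.
Proof.
elim=> [w|k w w' w'' _ IH /fmove_sym stp]; first exact: chain0.
by rewrite -addn1 addnC; apply: chain_trans IH; apply: chainS (chain0 _) stp.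
Qed.

Lemma eqv_refl s : s ~~~ s.
Proof. by exists 0; apply: chain0. Qed.

Lemma eqv_sym s t : s ~~~ t -> t ~~~ s.
Proof. by case=> n /chain_sym; exists n. Qed.

Lemma eqv_trans t s u : s ~~~ t -> t ~~~ u -> s ~~~ u.
Proof. by move=> [m st] [n tu]; exists (m + n); apply: chain_trans tu. Qed.

Lemma eqv_ctx x y s t : s ~~~ t -> x ++ s ++ y ~~~ x ++ t ++ y.
Proof.
case=> n; elim=> [w|k w w' w'' _ IH [sg [x' [y' [c [e ->]]]]]].
  exact: eqv_refl.
rewrite e in IH.
apply: eqv_trans IH _; exists 1; apply: chainS (chain0 _) _.
by exists sg, (x ++ x'), (y' ++ y), c; rewrite !catA.
Qed.

Lemma eqv_catl x s t : s ~~~ t -> x ++ s ~~~ x ++ t.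
Proof. by move/(eqv_ctx x [::]); rewrite !cats0. Qed.

Lemma eqv_catr y s t : s ~~~ t -> s ++ y ~~~ t ++ y.
Proof. by move/(eqv_ctx [::] y). Qed.

Lemma eqv_rest sg tau c : rest sg c ~~~ rest tau c.
Proof.
case: (eqVneq sg tau) => [->|ne]; first exact: eqv_refl.
exists 1; apply: chainS (chain0 _) _; exists sg, [::], [::], c.
by rewrite !cats0; split=> //=; case: sg tau ne => [] [].
Qed.

Lemma eqv_face_sign sg tau a : face sg a ~~~ face tau a.
Proof. by rewrite !faceE; apply: (@eqv_catl [:: a]); apply: eqv_rest. Qed.

Lemma ftermP (p q : qpath Q) : fterm p q <-> p.1 = q.1 /\ p.2 ~~~ q.2.
Proof.
split.
  elim=> {p q} [p q [e [x [y [a [es et]]]]]|p|p q _ [-> H]|p q r _ [-> H1] _ [-> H2]].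
  - split=> //; rewrite es et rposE rnegE.
    exact/eqv_ctx/eqv_rest.
  - by split=> //; apply: eqv_refl.
  - by split=> //; apply: eqv_sym.
  - by split=> //; apply: eqv_trans H2.
case: p q => [v s] [v' t] /= [<- [n]].
elim=> [w|k w1 w2 w3 _ IH [sg [x [y [c [e2 e3]]]]]]; first exact: rst_refl.
apply: rst_trans IH _.
case: sg e2 e3 => /= e2 e3; [apply: rst_step|apply/rst_sym/rst_step];
  by split=> //; exists x, y, c; rewrite rposE rnegE.
Qed.

Lemma is_walk_cat v s t : is_walk v (s ++ t) = is_walk v s && is_walk (wend v s) t.
Proof. by elim: s v => //= a s IH v; rewrite IH andbA. Qed.

Lemma wend_cat v s t : wend v (s ++ t) = wend (wend v s) t.
Proof. by rewrite /wend map_cat last_cat. Qed.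

(** * Walks, and the centrality of polygon boundaries *)

Hypothesis dimQ : is_dimer Q.

Lemma tl_turn sg a : tl (turn sg a) = hd a.
Proof. by case: dimQ => /(_ a) [] ? ? _ _ _; case: sg. Qed.

Lemma is_walk_traject v sg a k :
  is_walk v (traject (turn sg) a k.+1) = (tl a == v).
Proof.
elim: k v a => [|k IH] v a; first by rewrite /= andbT.
rewrite trajectS -cat1s is_walk_cat IH tl_turn /= andbT.
by rewrite /wend /= eqxx andbT.
Qed.

Lemma wend_traject v sg a k :
  wend v (traject (turn sg) a k.+1) = hd (iter k (turn sg) a).
Proof. by rewrite trajectSr /wend map_rcons last_rcons. Qed.

Lemma order_ge3 sg a : 2 < fingraph.order (turn sg) a.
Proof. by case: dimQ => _ /(_ a) [] ? ? _ _; case: sg. Qed.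

Lemma is_walk_rest v sg c : is_walk v (rest sg c) = (hd c == v).
Proof.
rewrite /rest; case E: (fingraph.order (turn sg) c) (order_ge3 sg c) => [|[|n]] // _.
by rewrite is_walk_traject tl_turn.
Qed.

Lemma wend_rest v sg c : wend v (rest sg c) = tl c.
Proof.
rewrite /rest; case E: (fingraph.order (turn sg) c) (order_ge3 sg c) => [|[|n]] // _.
rewrite wend_traject -(tl_turn sg) -iterSr -iterS -E iter_order //.
exact: turn_inj.
Qed.

Lemma is_walk_face v sg a : is_walk v (face sg a) = (tl a == v).
Proof. by rewrite faceE /= is_walk_rest eqxx andbT. Qed.

Lemma eqv_walk v s t : s ~~~ t -> is_walk v s = is_walk v t.
Proof.
case=> n; elim=> // k w w' w'' _ -> [sg [x [y [c [-> ->]]]]].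
by rewrite !is_walk_cat !is_walk_rest !wend_rest.
Qed.

(** Turn around the vertex: passing from an incoming arc to its image under [rot] crosses one corner
    on each side, each crossing being a single F-term exchange. The link of the vertex is one
    circle, so every corner is reached. *)
Lemma eqv_face sg tau a b : tl a = tl b -> face sg a ~~~ face tau b.
Proof.
have step e : face true (turn true (Defs.rot e)) ~~~ face true (turn true e).
  have -> : turn true e = turn false (Defs.rot e) by rewrite [RHS]permKV.
  apply: eqv_trans (eqv_face_sign false true _); rewrite !face_turn.
  exact/eqv_catr/eqv_rest.
have conn e i :
    face true (turn true (iter i (@Defs.rot Q) e)) ~~~ face true (turn true e).
  elim: i => [|i IH]; first exact: eqv_refl.
  exact: eqv_trans (step _) IH.
move=> ab; apply: eqv_trans (eqv_face_sign sg true a) _.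
apply: eqv_trans (eqv_face_sign true tau b).
pose pr c := ((dpos Q)^-1)%g c.
have prK c : turn true (pr c) = c by exact: permKV.
have hdpr c : hd (pr c) = tl c by rewrite -(tl_turn true) prK.
rewrite -(prK a) -(prK b).
case: dimQ => _ _ _ /(_ (pr b) (pr a)); rewrite !hdpr ab => /(_ erefl).
by move=> /iter_findex <-; apply: conn.
Qed.

(** Slide the boundary past one arc [e] at a time: it may be chosen as [e] followed by [rest sg e],
    and [rest sg e] followed by [e] is again a boundary, now at the head of [e]. *)
Lemma face_central sg tau a b x :
  is_walk (tl a) x -> wend (tl a) x = tl b -> face sg a ++ x ~~~ x ++ face tau b.
Proof.
elim: x a sg => [|e x IH] a sg /=.
  by move=> _ ab; rewrite cats0; apply: eqv_face.
move=> /andP[/eqP ea wx] wb.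
apply: (@eqv_trans (face sg e ++ e :: x)); first exact/eqv_catr/eqv_face.
rewrite faceE -cat1s -[e :: x]cat1s catA.
rewrite -[(_ :: _) ++ [:: e]]/([:: e] ++ (rest sg e ++ [:: e])).
rewrite -face_turn -catA; apply: (@eqv_catl [:: e]).
by apply: IH; rewrite tl_turn.
Qed.

(** * Cancellation of arbitrary words on either side *)

Hypothesis canQ : cancellation_consistent Q.

Lemma face_cycle_face sg a : face_cycle_at (tl a) (face sg a).
Proof. by exists a; split=> //; case: sg; [left|right]; rewrite map_iter_traject. Qed.

Lemma face_cancel v sg tau a b x y :
  is_walk v x -> is_walk v y -> tl a = wend v x -> tl b = wend v y ->
  x ++ face sg a ~~~ y ++ face tau b -> x ~~~ y.
Proof.
move=> wx wy ax bY xy.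
suff /ftermP[] : fterm (v, x) (v, y) by [].
apply: (@canQ (v, x) (v, y) wx wy (face sg a) (face tau b)).
- by rewrite -[pend _]/(wend v x) -ax; apply: face_cycle_face.
- by rewrite -[pend _]/(wend v y) -bY; apply: face_cycle_face.
- exact/ftermP.
Qed.

Lemma eqv_cancelr v x y s : is_walk v (x ++ s) -> is_walk v (y ++ s) ->
  x ++ s ~~~ y ++ s -> x ~~~ y.
Proof.
elim: s x y => [|a s IH] x y; first by rewrite !cats0.
rewrite -!cat_rcons => wx wy /(IH _ _ wx wy) xy.
move: wx wy; rewrite -!cats1 -!catA !is_walk_cat /= !andbT.
move=> /and3P[wx /eqP ax _] /and3P[wy /eqP ay _].
apply: (@face_cancel v true true a a) => //.
move/(eqv_catr (rest true a)): xy.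
by rewrite -!cats1 -!catA faceE.
Qed.

Lemma exists_out v : exists a, tl a = v.
Proof. by case: dimQ => _ _ /(_ v) [a <-] _; exists (turn true a); rewrite tl_turn. Qed.

Lemma eqv_cancel1 v a x y : is_walk v (a :: x) -> is_walk v (a :: y) ->
  a :: x ~~~ a :: y -> x ~~~ y.
Proof.
move=> /= /andP[_ wx] /andP[_ wy] xy.
have [b bE] := exists_out (wend (hd a) x).
have [c cE] := exists_out (wend (hd a) y).
apply: (@face_cancel (hd a) true true b c) => //.
(* Prepending [rest true a] completes [a] to a boundary; centrality moves it to the right end, where
   it can be cancelled. *)
have C z d : is_walk (hd a) z -> tl d = wend (hd a) z ->
    rest true a ++ a :: z ~~~ z ++ face true d.
  move=> wz dE; rewrite -cat1s catA -face_turn.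
  by apply: face_central; rewrite tl_turn.
apply: eqv_trans (C _ _ wy cE); apply: eqv_trans (eqv_sym (C _ _ wx bE)) _.
exact: eqv_catl.
Qed.

Lemma eqv_cancell v s x y : is_walk v (s ++ x) -> is_walk v (s ++ y) ->
  s ++ x ~~~ s ++ y -> x ~~~ y.
Proof.
elim: s v => //= a s IH v wx wy xy.
apply: (IH (hd a)); last exact: eqv_cancel1 wx wy xy.
  by case/andP: wx.
by case/andP: wy.
Qed.

(** * Words that admit no F-term move *)

Hypothesis ntQ : without_triangles Q.

Lemma order_ge4 sg a : 3 < fingraph.order (turn sg) a.
Proof.
rewrite ltn_neqAle order_ge3 andbT eq_sym; apply/eqP.
by case: (ntQ a) => ? ?; case: sg.
Qed.

Lemma restE sg c : exists u, rest sg c =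
  turn sg c :: turn sg (turn sg c) :: turn sg (turn sg (turn sg c)) :: u.
Proof.
rewrite /rest; case: (fingraph.order _ _) (order_ge4 sg c) => [|[|[|[|n]]]] //= _.
by eexists.
Qed.

Lemma size_rest sg c : size (rest sg c) = (fingraph.order (turn sg) c).-1.
Proof. by rewrite size_traject. Qed.

Lemma fmove_size s t : fmove s t -> 2 < size s.
Proof.
case=> sg [x [y [c [-> _]]]]; rewrite !size_cat size_rest.
by have := order_ge4 sg c; case: (fingraph.order _ _) => [|[|[|[|n]]]] // _;
  rewrite addnCA !addSn.
Qed.

Lemma chain_rigid n s t : chain n s t -> (forall u, ~ fmove s u) -> t = s.
Proof.
move=> st ns; elim: st ns => // k w w' w'' _ IH stp ns.
by case: (ns w''); rewrite -(IH ns).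
Qed.

Lemma eqv_short s t : size s <= 2 -> s ~~~ t -> t = s.
Proof.
by move=> sz [n] /chain_rigid; apply=> u /fmove_size; rewrite ltnNge sz.
Qed.

Lemma eqv_nil s : [::] ~~~ s -> s = [::].
Proof. exact: eqv_short. Qed.

(* If a proper run e1 of a face F contained all but the arc c of another face,
   cancelling e1 between the two boundary cycles would identify the rest of F,
   at least two arcs, with the single arc c. *)
Lemma run_rigid sg e k u : k.+1 < fingraph.order (turn sg) e ->
  ~ fmove (traject (turn sg) e k) u.
Proof.
move=> ltk [tau [x [y [c [E _]]]]].
have sz : k = size x + (size (rest tau c) + size y).
  by rewrite -!size_cat -E size_traject.
set l := size (rest tau c) in sz.
pose e1 := iter (size x) (turn sg) e.
have R : rest tau c = traject (turn sg) e1 l.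
  have szl : size (traject (turn sg) e1 l) = size (rest tau c).
    by rewrite size_traject.
  move/eqP: E; rewrite sz !trajectD eqseq_cat ?size_traject // (eqseq_cat _ _ szl).
  by case/and3P=> _ /eqP <- _.
have e1E : e1 = turn tau c.
  by have [w] := restE tau c; rewrite R; case: (l) => //= l' [].
pose j := fingraph.order (turn sg) e1 - l.
have ltl : l.+1 < fingraph.order (turn sg) e1.
  rewrite order_turn; apply: leq_ltn_trans ltk.
  by rewrite ltnS sz addnCA leq_addr.
have j2 : 1 < j by rewrite ltn_subRL addn1.
have F : face sg e1 = rest tau c ++ traject (turn sg) (iter l (turn sg) e1) j.
  by rewrite R -trajectD subnKC // ltnW // ltnW.
have F' : face tau e1 = rest tau c ++ [:: c] by rewrite e1E face_turn.
have : [:: c] ~~~ traject (turn sg) (iter l (turn sg) e1) j.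
  apply: (@eqv_cancell (tl e1) (rest tau c)); rewrite -?F -?F' ?is_walk_face //.
  exact: eqv_face.
move/eqv_short => /(_ isT) /(congr1 size); rewrite size_traject => jE.
by rewrite jE in j2.
Qed.

(** * Arcs whose two polygons continue with the same arc *)

Definition flat a := turn true a == turn false a.

Lemma flatP sg tau a : flat a -> turn sg a = turn tau a.
Proof. by move=> /eqP; case: sg tau => [] []. Qed.

Lemma nflatP sg a : ~~ flat a -> turn (~~ sg) a != turn sg a.
Proof. by case: sg; rewrite // eq_sym. Qed.

(** Cancelling the common first arc of the two rests leaves equivalent runs; one of them is rigid by
    [run_rigid], so they are equal, and their first arcs are the next turns. Hence a flat arc has
    the same polygon on both sides, and the move across it changes nothing. *)
Lemma flat_turn sg a : flat a -> flat (turn sg a).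
Proof.
move=> fa; rewrite (flatP sg true fa).
have restS tau : rest tau a = turn true a ::
    traject (turn tau) (turn tau (turn true a)) (fingraph.order (turn tau) a).-2.
  rewrite (flatP true tau fa) /rest.
  by case: (fingraph.order _ _) (order_ge4 tau a) => [|[]].
have [e_true e_false] := (restS true, restS false).
set p := traject _ _ _ in e_true; set q := traject _ _ _ in e_false.
have [n] : p ~~~ q.
  apply: (@eqv_cancel1 (hd a) (turn true a)); rewrite -?e_true -?e_false.
  - by rewrite is_walk_rest.
  - by rewrite is_walk_rest.
  - exact: eqv_rest.
move=> /chain_rigid qp.
have {}qp : q = p.
  apply: qp => u; apply: run_rigid; rewrite (order_turn true a 2).
  by case: (fingraph.order _ _) (order_ge4 true a) => [|[]].
move: qp; rewrite /p /q.
case: (fingraph.order (turn true) a) (order_ge4 true a) => [|[|[|]]] // k _.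
case: (fingraph.order (turn false) a) (order_ge4 false a) => [|[|[|]]] // m _.
by case=> E _; rewrite /flat E.
Qed.

Lemma flat_iter sg a k : flat a -> flat (iter k (turn sg) a).
Proof. by move=> fa; elim: k => //= k; apply: flat_turn. Qed.

Lemma flat_prev sg a : flat (turn sg a) -> flat a.
Proof.
move/(flat_iter sg (fingraph.order (turn sg) a).-1).
by rewrite -iterSr order_predK iter_order //; apply: turn_inj.
Qed.

Lemma flat_rest sg tau a : flat a -> rest sg a = rest tau a.
Proof.
move=> fa.
have it k : iter k (turn sg) a = iter k (turn tau) a.
  elim: k => //= k <-; apply: flatP; exact: flat_iter.
have oE : fingraph.order (turn sg) a = fingraph.order (turn tau) a.
  apply: eq_card => x; rewrite !inE.
  by apply/idP/idP => /iter_findex <-; [rewrite it|rewrite -it]; apply: fconnect_iter.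
rewrite /rest oE -[turn sg a]/(iter 1 (turn sg) a) -[turn tau a]/(iter 1 (turn tau) a).
by rewrite -!map_iter_traject; apply: eq_map.
Qed.

(** * Changes of the first arc along a chain of moves *)

Lemma last_head_change n s g t : chain n s (g :: t) -> ohead s <> Some g ->
  exists sg c y u m m',
    [/\ turn sg c = g, ~~ flat c, rest sg c = g :: u,
        m < n /\ chain m s (rest (~~ sg) c ++ y) &
        m' < n /\ chain m' (u ++ y) t].
Proof.
move E: (g :: t) => w sw; elim: sw t E => [s' t <- //|].
move=> k s' w' w'' sw IH [sg [x [y [c [ew' ew'']]]]] t E ns.
case: x ew' ew'' => [|e x] /= ew' ew''.
  (* A move across a flat arc leaves the word unchanged, so the last effective change of head lies
     earlier. *)
  have [fc|nfc] := boolP (flat c).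
    have [|//|sg' [d [z [u [m [m' [? ? ? [? ?] [? ?]]]]]]]] := IH t.
      by rewrite E ew' ew'' (flat_rest sg (~~ sg) fc).
    exists sg', d, z, u, m, m'; split=> //; split=> //; exact: leqW.
  have [u rE] := restE (~~ sg) c; rewrite ew'' rE in E.
  case: E => gE tE.
  exists (~~ sg), c, y, (turn (~~ sg) g :: turn (~~ sg) (turn (~~ sg) g) :: u), k, 0.
  split=> //; first by rewrite gE.
    by rewrite negbK -ew'.
  by split=> //; rewrite gE tE; apply: chain0.
(* A move that starts beyond the first arc only prolongs the chain of tails. *)
case: (E); rewrite ew'' => -[ge tE].
have [|//|sg' [d [z [u [m [m' [? ? ? [? ?] [lt st]]]]]]]] := IH (x ++ rest sg c ++ y).
  by rewrite ge ew'.
exists sg', d, z, u, m, m'.+1; split=> //; split=> //; first exact: leqW.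
by apply: chainS st _; exists sg, x, y, c; rewrite tE.
Qed.

Definition contains_face s : Prop := exists x sg a y, s ~~~ x ++ face sg a ++ y.

Lemma contains_face_cons a s : contains_face s -> contains_face (a :: s).
Proof.
move=> [x [sg [b [y e]]]]; exists (a :: x), sg, b, y.
exact: (@eqv_catl [:: a]).
Qed.

Lemma contains_face_eqv s t : s ~~~ t -> contains_face s -> contains_face t.
Proof.
move=> st [x [sg [b [y e]]]]; exists x, sg, b, y.
exact: eqv_trans (eqv_sym st) e.
Qed.

(* Descent: at the last change of head to g, across an arc c, the polygon used
   lies on either side of g. On one side the claim holds. On the other the tails
   after g start with the two arcs turn to g, and as that polygon has a further
   arc, the shorter chain of tails is again of the same kind. *)
Lemma head_change_straight n s sg g t :
  chain n s (g :: turn sg g :: t) -> ohead s <> Some g ->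
  contains_face s \/ exists c y, turn sg c = g /\ s ~~~ rest sg c ++ y.
Proof.
elim/ltn_ind: n => n IH in s sg g t * => sw ns.
have [tau [c [y [u [m [m' [cg nfc rE [_ sm] [lt um]]]]]]]] := last_head_change sw ns.
have s_rest : s ~~~ rest tau c ++ y.
  by apply: (@eqv_trans (rest (~~ tau) c ++ y)); [exists m|apply/eqv_catr/eqv_rest].
have [ts|nts] := eqVneq tau sg; first by right; exists c, y; rewrite -ts.
have tE : tau = ~~ sg by move: nts; case: (tau) (sg) => [] [].
left; apply: contains_face_eqv (eqv_sym s_rest) _; rewrite rE /=.
have [w uE] : exists w, u = turn tau g :: turn tau (turn tau g) :: w.
  by have [w] := restE tau c; rewrite rE cg => -[->]; eexists.
have nfg : ~~ flat g by apply: contra nfc; rewrite -cg; apply: flat_prev.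
move/chain_sym: um (um); rewrite {1}uE => um um'.
case: (IH m' lt _ tau (turn tau g) (w ++ y) um).
- by move=> [] /eqP; rewrite tE; apply/negP; rewrite eq_sym; apply: nflatP.
- move=> cf; apply: contains_face_cons; apply: contains_face_eqv cf.
  by apply: eqv_sym; exists m'.
(* Injectivity of [turn tau] gives [d = g], so the tail starts with all of the polygon of [g] except
   [g], which stands just before it. *)
- move=> [d [z [/turn_inj -> e]]].
  exists [::], tau, g, z; rewrite faceE; apply: (@eqv_catl [:: g]).
  by apply: eqv_trans e; exists m'.
Qed.

(** After cancelling [g] the heads differ while one side goes straight, so [head_change_straight]
    applies; the arc it produces can only be [g], which closes up the boundary. *)
Lemma fork_contains_face v sg g u w :
  is_walk v (g :: turn (~~ sg) g :: u) -> ~~ flat g ->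
  g :: turn (~~ sg) g :: u ~~~ g :: turn sg g :: turn sg (turn sg g) :: w ->
  contains_face (g :: turn (~~ sg) g :: u).
Proof.
move=> wu nfg e.
have [n ch] := eqv_cancel1 wu (etrans (esym (eqv_walk v e)) wu) e.
case: (head_change_straight ch).
- by case=> /eqP; apply/negP; apply: nflatP.
- exact: contains_face_cons.
- move=> [d [z [/turn_inj -> e']]].
  by exists [::], sg, g, z; rewrite faceE; apply: (@eqv_catl [:: g]).
Qed.

Lemma two_heads n v a b s t : is_walk v (a :: s) ->
  chain n (a :: s) (b :: t) -> a <> b ->
  contains_face (a :: s) \/
  exists sg c y, [/\ turn sg c = b, turn (~~ sg) c = a & a :: s ~~~ rest sg c ++ y].
Proof.
move=> ws; elim/ltn_ind: n => n IH in b t * => sw ab.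
have [|sg [c [y [u [m [m' [cb nfc rE [lt sm] _]]]]]]] := last_head_change sw.
  by case.
have s_rest : a :: s ~~~ rest (~~ sg) c ++ y by exists m.
(* Before the last change of head the word starts with the other successor of [c]. If that is not
   [a], induction compares it with [a] across an arc [c']. *)
have [ac|/eqP nac] := eqVneq a (turn (~~ sg) c).
  right; exists sg, c, y; split=> //.
  by apply: eqv_trans s_rest _; apply/eqv_catr/eqv_rest.
have [w rE'] := restE (~~ sg) c.
move: sm; rewrite rE' => sm.
case: (IH m lt _ _ sm nac) => [|[tau [c' [y' [c'b c'a s_rest']]]]]; first by left.
have [ts|nts] := eqVneq tau (~~ sg).
  move: c'b c'a; rewrite ts negbK => /turn_inj ->; rewrite cb => ba.
  by case: ab.
have tE : tau = sg by move: nts; case: (tau) (sg) => [] [].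
(* Here the polygons of [c] and [c'] both start with [b1] but leave it on opposite sides: a fork. *)
rewrite {}tE {nts} in c'b c'a s_rest'; left.
set b1 := turn (~~ sg) c in rE' c'b nac.
have nfb1 : ~~ flat b1 by apply: contra nfc; apply: flat_prev.
have [w' rE''] := restE sg c'; rewrite c'b in rE''.
rewrite rE' rE'' in s_rest s_rest'.
apply: contains_face_eqv (eqv_sym s_rest) _.
apply: (fork_contains_face (v := v) (sg := sg)) nfb1 _.
  by rewrite -(eqv_walk v s_rest).
exact: eqv_trans (eqv_sym s_rest) s_rest'.
Qed.

Lemma contains_face_head v s b : is_walk v s -> contains_face s -> tl b = v ->
  exists y, forall sg, s ~~~ face sg b ++ y.
Proof.
move=> ws [x [tau [a [y e]]]] bv; exists (x ++ y) => sg.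
apply: (eqv_trans e); rewrite !catA; apply: eqv_catr; apply: eqv_sym.
have := ws; rewrite (eqv_walk v e) !is_walk_cat is_walk_face => /and3P[wx /eqP ax _].
by apply: face_central; rewrite bv.
Qed.

(** * Runs along polygon boundaries and their common multiples with an arc *)

Definition runs : seq (seq A) :=
  [::] :: [seq traject (turn p.1) p.2 k
          | p <- enum {: bool * A}, k <- iota 0 (fingraph.order (turn p.1) p.2).+1].

Lemma traject_runs sg a k :
  k <= fingraph.order (turn sg) a -> traject (turn sg) a k \in runs.
Proof.
move=> le_k; rewrite inE; apply/orP; right; apply/allpairsPdep.
by exists (sg, a), k; rewrite mem_enum mem_iota.
Qed.

Lemma runsP s : s \in runs -> s = [::] \/
  exists sg a k, k < fingraph.order (turn sg) a /\ s = traject (turn sg) a k.+1.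
Proof.
rewrite inE => /orP[/eqP|/allpairsPdep[[sg a] [k [_]]]]; first by left.
rewrite mem_iota /= add0n ltnS; case: k => [|k] lek ->; first by left.
by right; exists sg, a, k.
Qed.

Lemma run_completion sg a k : k < fingraph.order (turn sg) a ->
  rest sg a = traject (turn sg) (turn sg a) k ++
    traject (turn sg) (iter k.+1 (turn sg) a) ((fingraph.order (turn sg) a).-1 - k).
Proof. by move=> ltk; rewrite iterSr -trajectD subnKC // -ltnS order_predK. Qed.

(* A common multiple of the arc a and of a nonempty run s is a multiple of
   a ++ s' for some run s' such that a ++ s' is a multiple of s. *)
Lemma run_lcm v a s y z : is_walk v (a :: z) -> s \in runs -> s <> [::] ->
  a :: z ~~~ s ++ y ->
  exists s' t z', [/\ s' \in runs, z ~~~ s' ++ z' & y ~~~ t ++ z'].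
Proof.
move=> wz sr s0 zs.
have ws : is_walk v (s ++ y) by rewrite -(eqv_walk v zs).
have av : tl a = v by case/andP: wz => /eqP.
case: (runsP sr) => [//|[sg [b [k [ltk sE]]]]].
have bv : tl b = v by move: ws; rewrite sE /= => /andP[/eqP].
have cancel_s y' : a :: z ~~~ s ++ y' -> y ~~~ y'.
  move=> zs'; apply: (@eqv_cancell v s) => //; first by rewrite -(eqv_walk v zs').
  exact: eqv_trans (eqv_sym zs) zs'.
have cancel_a z' : a :: z ~~~ a :: z' -> z ~~~ z'.
  by move=> e; apply: (@eqv_cancel1 v a) => //; rewrite -(eqv_walk v e).
have faceD : face sg b = s ++
    traject (turn sg) (iter k.+1 (turn sg) b) ((fingraph.order (turn sg) b).-1 - k).
  by rewrite faceE (run_completion ltk) sE.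
(* If a boundary divides the multiple, move it to the front: both [a] and [s] can be completed to
   it. *)
have with_face : contains_face (a :: z) ->
    exists s' t z', [/\ s' \in runs, z ~~~ s' ++ z' & y ~~~ t ++ z'].
  move=> cf; have [z' z'E] := contains_face_head wz cf av.
  exists (rest true a),
    (traject (turn sg) (iter k.+1 (turn sg) b) ((fingraph.order (turn sg) b).-1 - k)), z'.
  split; first by rewrite /rest traject_runs // (order_turn true a 1) leq_pred.
    by apply: cancel_a; apply: eqv_trans (z'E true) _; rewrite faceE; apply: eqv_refl.
  apply: cancel_s; rewrite catA -faceD; apply: eqv_trans (z'E sg) _.
  by apply/eqv_catr/eqv_face; rewrite av.
have [ab|/eqP nab] := eqVneq a b.
  exists (traject (turn sg) (turn sg b) k), [::], y; split; last exact: eqv_refl.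
    by apply: traject_runs; rewrite (order_turn sg b 1) ltnW.
  by apply: cancel_a; move: zs; rewrite sE ab.
have [n zs_n] := zs.
rewrite sE /= in zs_n.
have {zs_n} [/with_face //|[tau [c [y' [cb ca e]]]]] := two_heads wz zs_n nab.
have nfc : ~~ flat c.
  by apply/negP => /(flatP tau (~~ tau)); rewrite ca cb => ba; case: nab.
have ob : fingraph.order (turn tau) b = fingraph.order (turn tau) c.
  by rewrite -cb (order_turn tau c 1).
(* When [s] is a run on the polygon of [c] through [b], the common multiple is [rest tau c],
   equivalent to [rest (~~ tau) c], which starts with [a]. *)
have along j : j.+1 < fingraph.order (turn tau) b -> s = traject (turn tau) b j.+1 ->
    exists s' t z', [/\ s' \in runs, z ~~~ s' ++ z' & y ~~~ t ++ z'].
  move=> ltj sj; have lt'j : j.+1 < fingraph.order (turn tau) c by rewrite -ob.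
  exists (behead (rest (~~ tau) c)), (traject (turn tau) (iter j.+2 (turn tau) c)
    ((fingraph.order (turn tau) c).-1 - j.+1)), y'.
  have [w wE] := restE (~~ tau) c; split.
  - rewrite /rest; case oc: (_.-1) => [|m] /=; first by rewrite inE.
    apply: traject_runs; rewrite (order_turn (~~ tau) c 2).
    by rewrite -(order_predK (~~ tau)) oc ltnW.
  - apply: cancel_a; apply: eqv_trans e _.
    have -> : a :: behead (rest (~~ tau) c) ++ y' = rest (~~ tau) c ++ y'.
      by rewrite wE -ca.
    exact/eqv_catr/eqv_rest.
  - apply: cancel_s; apply: eqv_trans e _.
    by rewrite (run_completion lt'j) cb -sj catA; apply: eqv_refl.
have [ts|nts] := eqVneq tau sg.
  move: ltk; rewrite leq_eqVlt => /orP[/eqP k_full|ltk].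
    apply: with_face; exists [::], sg, b, y; rewrite /face -k_full -sE; exact: zs.
  by apply: (along k); rewrite ts.
have sgE : sg = ~~ tau by move: nts; case: (tau) (sg) => [] [].
(* A single arc is a run on either of its polygons; a longer run on the wrong side creates a fork at
   [b]. *)
case: k => [|k] in ltk sE faceD *; first by apply: (along 0) => //; apply/ltnW/order_ge3.
apply: with_face; apply: contains_face_eqv (eqv_sym zs) _.
have [w rE] := restE tau c; rewrite cb in rE.
move: ws zs e; rewrite rE sE sgE /= => ws zs' e.
apply: fork_contains_face ws _ _; last exact: eqv_trans (eqv_sym zs') e.
by apply: contra nfc; rewrite -cb; apply: flat_prev.
Qed.

(** * Products of runs, their suffixes and the length bound *)

Fixpoint products k : seq (seq A) :=
  if k is k'.+1 then [seq s ++ w | s <- runs, w <- products k'] else [:: [::]].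

(** Exactly [k] factors also cover fewer, the empty word being a run. *)
Definition run_product k s : Prop := exists2 w, w \in products k & s ~~~ w.

Lemma run_product_eqv k s t : s ~~~ t -> run_product k t -> run_product k s.
Proof. by move=> st [w wk tw]; exists w => //; apply: eqv_trans tw. Qed.

Lemma run_product_cat k s t : s \in runs -> run_product k t -> run_product k.+1 (s ++ t).
Proof.
move=> sr [w wk tw]; exists (s ++ w); last exact: eqv_catl.
by apply/allpairsP; exists (s, w).
Qed.

Lemma run_product_behead k v a s :
  is_walk v (a :: s) -> run_product k (a :: s) -> run_product k s.
Proof.
elim: k => [|k IH] in v a s * => ws.
  by case=> w; rewrite inE => /eqP -> /eqv_sym /eqv_nil.
have strip t u v' : is_walk v' (t ++ u) -> run_product k (t ++ u) -> run_product k u.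
  elim: t v' => //= b t IHt v' wt pt; apply: (IHt (hd b)).
    by case/andP: wt.
  exact: IH wt pt.
case=> _ /allpairsP[[r w] /= [rr wk ->]] e.
have [r0|/eqP r0] := eqVneq r [::].
  rewrite r0 /= in e.
  rewrite -[s]cat0s; apply: run_product_cat; first by rewrite inE eqxx.
  by apply: (IH v a s ws); exists w.
(* Removing [a] turns the first factor [r] into a run [r'] and leaves [s'], a suffix of the
   remaining product up to equivalence, so induction on [k] applies through [strip]. *)
have [r' [t [s' [rr' ss' wt]]]] := run_lcm ws rr r0 e.
apply: run_product_eqv ss' _; apply: run_product_cat => //.
have ww : is_walk (wend v r) (t ++ s').
  rewrite -(eqv_walk _ wt); move: ws; rewrite (eqv_walk v e) is_walk_cat.
  by case/andP.
apply: strip ww _; apply: run_product_eqv (eqv_sym wt) _; exists w => //.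
exact: eqv_refl.
Qed.

Lemma run_product_drop k v s i :
  is_walk v s -> run_product k s -> run_product k (drop i s).
Proof.
elim: i s v => [|i IH] [|a s] v //= /[dup] ws /andP[_ ws'] ps.
by apply: IH ws' _; apply: run_product_behead ws ps.
Qed.

Lemma run_product_size s : run_product (size s) s.
Proof.
elim: s => [|a s IH]; first by exists [::] => //; apply: eqv_refl.
rewrite -cat1s; apply: run_product_cat => //.
by apply: (@traject_runs true a 1); rewrite -order_predK.
Qed.

Lemma suffix_absorbed v u s : is_walk v (u ++ s) -> u ++ s ~~~ s -> u = [::].
Proof.
move=> ws e; apply: eqv_nil; apply: eqv_sym.
apply: (@eqv_cancelr v u [::] s) => //.
by rewrite /= -(eqv_walk v e).
Qed.

Lemma run_product_size_bound k v s :
  is_walk v s -> run_product k s -> size s < size (products k).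
Proof.
move=> ws ps; rewrite ltnNge; apply/negP => le_s.
(* Pigeonhole on all suffixes, the empty one included, hence the index range of [size s] plus one
   elements. *)
have [f fP] : exists f : 'I_(size s).+1 -> seq A,
    forall i, f i \in products k /\ drop i s ~~~ f i.
  have cov (i : 'I_(size s).+1) : exists w, w \in products k /\ drop i s ~~~ w.
    by have [w wk e] := run_product_drop i ws ps; exists w.
  exact: fin_all_exists cov.
have inj_lt i j : f i = f j -> i <= j -> i = j.
  move=> fij le_ij.
  have dij : drop i s ~~~ drop j s.
    by apply: eqv_trans (fP i).2 _; rewrite fij; apply: eqv_sym (fP j).2.
  have wi : is_walk (wend v (take i s)) (drop i s).
    by have := ws; rewrite -{1}(cat_take_drop i s) is_walk_cat => /andP[].
  have dE : drop i s = take (j - i) (drop i s) ++ drop j s.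
    by rewrite -{1}(cat_take_drop (j - i) (drop i s)) drop_drop subnK.
  rewrite dE in wi dij; have := suffix_absorbed wi dij.
  move/(congr1 size); rewrite size_take size_drop.
  have := ltn_ord j; rewrite ltnS => le_j.
  move=> sz; apply/val_inj/eqP; rewrite eqn_leq le_ij /= -subn_eq0.
  by move: sz; case: ifP => [_ ->//|_ /eqP]; rewrite !subn_eq0; apply: leq_trans.
have f_inj : injective f.
  by move=> i j fij; case: (leqP i j) => [|/ltnW] le; [|apply/esym]; apply: inj_lt.
have : size (map f (enum 'I_(size s).+1)) <= size (products k).
  apply: uniq_leq_size; first by rewrite map_inj_uniq ?enum_uniq.
  by move=> _ /mapP[i _ ->]; case: (fP i).
by rewrite size_map size_enum_ord leqNgt ltnS le_s.
Qed.

End Words.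

Theorem theorem6p72 (Q : dimer) :
  is_dimer Q -> cancellation_consistent Q -> without_triangles Q ->
  bounded_type Q.
Proof.
(* Each arc is a run, so every word equivalent to [p] is a product of [size p] runs; the bound
   counts these products. *)
move=> dimQ canQ ntQ [v p] wp; exists (size (products Q (size p))).
move=> [w q] /ftermP[/= vw pq]; apply: ltnW.
apply: (run_product_size_bound dimQ canQ ntQ (v := v)).
  by rewrite -(eqv_walk dimQ v pq).
apply: run_product_eqv (eqv_sym pq) _; exact: run_product_size.
Qed.
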